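(* For $\mathbf{M}=(M_0,M_1,M_2,M_3,M_4)^t$ such that $M_0>0$, define $$e=\frac{M_0M_2-M_1^2}{M_0^2},\qquad q=\frac{(M_3M_0^2-M_1^3)-3M_1(M_0M_2-M_1^2)}{M_0^3},$$ $$\eta=\frac{-3M_1^4+M_4M_0^3-4M_0^2M_1M_3+6M_0M_1^2M_2}{M_0^4}.$$ Consider the system $$\begin{aligned} M_0&=\rho_1+\rho_2,\\ M_1&=\rho_1v_1+\rho_2v_2,\\ M_2-\sigma^2M_0&=\rho_1v_1^2+\rho_2v_2^2,\\ M_3-3\sigma^2M_1&=\rho_1v_1^3+\rho_2v_2^3,\\ M_4-6\sigma^2M_2+3\sigma^4M_0&=\rho_1v_1^4+\rho_2v_2^4 \end{aligned}$$ in the five unknowns $\rho_1,\rho_2,v_1,v_2,\sigma$. This system is well-defined on the phase space $$\Omega=\left\{\mathbf{M},\ M_0>0,\ e>0,\ \eta>e^2+\frac{q^2}{e},\ \text{and}\ \eta\le 3e^2\ \text{if}\ q=0\right\}.$$ Setting $\mathbf{U}=(\rho_1,\rho_2,\rho_1v_1,\rho_2v_2,\sigma)^t$, the function $\mathbf{U}=\mathbf{U}(\mathbf{M})$ is one-to-one and onto when $v_1\neq v_2$, and for all $v_1$ and $v_2$ provided that one sets $\rho_1=\rho_2$ in the case $v_1=v_2$. Moreover, $\sigma^2$ is given by the unique real root in $(0,e]$ of the third-order polynomial $$\mathcal{P}(\sigma_0)=2\sigma_0^3+(\eta-3e^2)\sigma_0+q^2,\qquad \sigma_0=\sigma^2-e$$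 (that is, $\sigma^2$ is the unique real value in $(0,e]$ for which $\mathcal{P}(\sigma^2-e)=0$).
   Context: In the two-node Gaussian extended quadrature method of moments (Gaussian-EQMOM), a number density function on $\mathbb{R}$ is approximated by $$f^{G}(v)=\sum_{\alpha=1}^2\frac{\rho_\alpha}{\sigma\sqrt{2\pi}}\exp\left(-\frac{(v-v_\alpha)^2}{2\sigma^2}\right),$$ with weights $\rho_1>0$, $\rho_2>0$, real velocity abscissas $v_1,v_2$ and a common standard deviation $\sigma\ge 0$ (when $\sigma=0$ the Gaussians are replaced by Dirac delta functions at $v_\alpha$). The system in the claim is equivalent to requiring that the moments of $f^G$ of orders $i=0,\dots,4$ equal the given $M_i$, i.e. $M_i=\int_{\mathbb{R}}f^G(v)v^i\,\mathrm{d}v$.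
   Formalization: If q=0 and η<3e², σ²=e is a second root in (0,e] (e.g. M=(1,0,1,0,2)), so there uniqueness is stated in (0,e), otherwise in (0,e]. As the system is symmetric in the nodes, U is a function with labels v1≤v2; it is onto parameters with ρ1,ρ2,σ>0. *)

(* Defs.v *)
From HB Require Import structures.
From mathcomp Require Import all_boot all_order all_algebra.
From mathcomp Require Import boolp classical_sets functions reals.
Set Implicit Arguments.
Unset Strict Implicit.
Unset Printing Implicit Defensive.
Import Order.TTheory GRing.Theory Num.Theory.
Local Open Scope classical_set_scope.
Local Open Scope ring_scope.

Section Moments.
Variable R : realType.
Implicit Types M : 'cV[R]_5.

(* In [M k 0] the numeral [k] is an element of 'I_5, so [M k 0] is the moment
   of order k. *)
Definition mom_e M : R :=
  (M 0 0 * M 2 0 - M 1 0 ^+ 2) / M 0 0 ^+ 2.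

Definition mom_q M : R :=
  ((M 3 0 * M 0 0 ^+ 2 - M 1 0 ^+ 3)
   - 3 * M 1 0 * (M 0 0 * M 2 0 - M 1 0 ^+ 2)) / M 0 0 ^+ 3.

Definition mom_eta M : R :=
  (- 3 * M 1 0 ^+ 4 + M 4 0 * M 0 0 ^+ 3 - 4 * M 0 0 ^+ 2 * M 1 0 * M 3 0
   + 6 * M 0 0 * M 1 0 ^+ 2 * M 2 0) / M 0 0 ^+ 4.

Definition Omega : set 'cV[R]_5 :=
  [set M : 'cV[R]_5 | [/\ 0 < M 0 0,
               0 < mom_e M,
               mom_e M ^+ 2 + mom_q M ^+ 2 / mom_e M < mom_eta M
             & mom_q M = 0 -> mom_eta M <= 3 * mom_e M ^+ 2]].

Definition sigma_poly M : {poly R} :=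
  2%:P * 'X^3 + (mom_eta M - 3 * mom_e M ^+ 2)%:P * 'X + (mom_q M ^+ 2)%:P.

Definition sigma2_root M (s : R) : Prop := root (sigma_poly M) (s - mom_e M).

End Moments.

Record unknowns (R : realType) := Unknowns {
  rho1 : R; rho2 : R; v1 : R; v2 : R; sigma : R }.

Section System.
Variable R : realType.
Implicit Types (M : 'cV[R]_5) (x : unknowns R).

Definition moment_system M x : Prop :=
  [/\ M 0 0 = rho1 x + rho2 x,
      M 1 0 = rho1 x * v1 x + rho2 x * v2 x,
      M 2 0 - sigma x ^+ 2 * M 0 0 =
        rho1 x * v1 x ^+ 2 + rho2 x * v2 x ^+ 2,
      M 3 0 - 3 * sigma x ^+ 2 * M 1 0 =
        rho1 x * v1 x ^+ 3 + rho2 x * v2 x ^+ 3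
    & M 4 0 - 6 * sigma x ^+ 2 * M 2 0 + 3 * sigma x ^+ 4 * M 0 0 =
        rho1 x * v1 x ^+ 4 + rho2 x * v2 x ^+ 4].

Definition solution M x : Prop :=
  [/\ 0 < rho1 x, 0 < rho2 x, 0 <= sigma x & moment_system M x].

Definition equal_weights_if_merged x : Prop := v1 x = v2 x -> rho1 x = rho2 x.

Definition swap_nodes x : unknowns R :=
  Unknowns (rho2 x) (rho1 x) (v2 x) (v1 x) (sigma x).

Definition Uvec x : 'cV[R]_5 :=
  \col_(i < 5)
    [:: rho1 x; rho2 x; rho1 x * v1 x; rho2 x * v2 x; sigma x]`_i.

(* The system is invariant under [swap_nodes]; for M |-> U to be a function the
   two nodes are labelled so that v1 <= v2.  The standard deviation is positive
   because sigma = 0 gives eta = e^2 + q^2 / e (or e = 0), which the strict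
   inequalities in [Omega] exclude. *)
Definition ordered_params : set (unknowns R) :=
  [set x : unknowns R | [/\ 0 < rho1 x, 0 < rho2 x, 0 < sigma x, v1 x <= v2 x
             & equal_weights_if_merged x]].

Definition distinct_params : set (unknowns R) :=
  [set x : unknowns R | [/\ 0 < rho1 x, 0 < rho2 x, 0 < sigma x & v1 x < v2 x]].

Definition Omega_distinct : set 'cV[R]_5 :=
  [set M : 'cV[R]_5 | Omega M /\ exists2 x, solution M x & v1 x <> v2 x].

End System.

(* Main.v *)
Require Import Defs.
From HB Require Import structures.
From mathcomp Require Import all_boot all_order all_algebra.
From mathcomp Require Import boolp classical_sets functions reals.
From mathcomp Require Import ring lra.
Set Implicit Arguments.
Unset Strict Implicit.
Unset Printing Implicit Defensive.
Import Order.TTheory GRing.Theory Num.Theory.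
Local Open Scope classical_set_scope.
Local Open Scope ring_scope.

(** Write a pair of weighted nodes in terms of its total weight r, its mean m
    and the scaled distance g = (v2 - v1) / r, so that v1 = m - rho2 * g and
    v2 = m + rho1 * g.  The nodes alone have variance d = rho1 * rho2 * g ^ 2;
    let c = (rho1 - rho2) * g be their skewness factor.  Adding the Gaussian
    kernel of variance s = sigma ^ 2, the central moments of the mixture become
      e = s + d,   q = d * c,   eta = d * (c ^ 2 + d) + 6 * s * d + 3 * s ^ 2,
    and the moment system just says that M0, M1, e, q, eta take the prescribed
    values ([moment_systemE], [central_moments_inj]).

    Eliminating s and c leaves the cubic 2 d^3 + (eta - 3 e^2) d = q^2, which is
    the polynomial of the statement at sigma_0 = - d.  Two positive roots of it
    coincide, since the cubic divided by d is strictly increasing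
    ([cubic_root_unique]); on Omega it is nonpositive at 0 and positive at e,
    which gives a root in [0, e[ and so s = e - d > 0 ([cubic_root_exists]).
    For q = 0 the number 0 is always a root, and it is the right one only when
    eta = 3 e^2; otherwise the positive root must be taken.

    Once d is known, c = q / d and the identity (r g)^2 = c^2 + 4 d determines g
    up to sign.  The two signs are exchanged by relabelling the nodes, and given
    g <> 0 the weights follow from r and c ([moments_inj_gap], [moments_fiber]).
    Conversely the formulas always produce weights between 0 and r, because
    |c| < r |g| as soon as d > 0 ([exists_ordered_solution]).  When d = 0 the
    nodes merge, which happens exactly for q = 0 and eta = 3 e^2, and only the
    convention of equal weights selects a solution.  Finally the moments of any
    parameters with sigma > 0 lie in Omega ([Omega_moments]), so the map is
    onto. *)

(** * The cubic equation for the variance of the nodes *)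

Section Cubic.
Variable R : realType.
Implicit Types e q eta d : R.

(** The polynomial of the statement at sigma_0 = - d, up to sign: working with
    the nonnegative unknown d = e - sigma^2 makes monotonicity visible. *)
Definition cubic e q eta d : R := 2 * d ^+ 3 + (eta - 3 * e ^+ 2) * d - q ^+ 2.

Lemma sigma2_rootE (M : 'cV[R]_5) s :
  sigma2_root M s <->
  cubic (mom_e M) (mom_q M) (mom_eta M) (mom_e M - s) = 0.
Proof.
have -> : sigma2_root M s <-> (sigma_poly M).[s - mom_e M] = 0.
  by rewrite /sigma2_root rootE; split=> /eqP.
have -> : (sigma_poly M).[s - mom_e M] =
    - cubic (mom_e M) (mom_q M) (mom_eta M) (mom_e M - s).
  rewrite /sigma_poly /cubic.
  by rewrite !(hornerD, hornerM, hornerC, hornerXn, hornerX); ring.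
split=> [/eqP|->]; last by rewrite oppr0.
by rewrite oppr_eq0 => /eqP.
Qed.

(** For positive d the quotient of the cubic by d is strictly increasing; the
    proof compares two such quotients with denominators cleared.  If
    eta = 3 e^2 the linear term vanishes and cubes are injective.  The remaining
    case really has two roots: for q = 0 and eta < 3 e^2 both 0 and a positive
    number are roots. *)
Lemma cubic_root_unique e q eta d d' : 0 <= d -> 0 <= d' ->
  cubic e q eta d = 0 -> cubic e q eta d' = 0 ->
  [\/ q <> 0, eta = 3 * e ^+ 2 | 0 < d /\ 0 < d'] -> d = d'.
Proof.
move=> d0 d'0 rd rd' nondeg.
have [pos|eta3] : 0 < 2 * d * d' * (d + d') + q ^+ 2 \/ eta = 3 * e ^+ 2.
- case: nondeg => [/eqP q0|?|[dp d'p]]; [left|by right|left].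
  + apply: ltr_wpDl; last by rewrite exprn_even_gt0.
    by rewrite !mulr_ge0 ?addr_ge0.
  + by apply: ltr_wpDr; rewrite ?sqr_ge0 // !mulr_gt0 ?addr_gt0.
- have /eqP : (d - d') * (2 * d * d' * (d + d') + q ^+ 2) = 0.
    have -> : (d - d') * (2 * d * d' * (d + d') + q ^+ 2) =
      d' * cubic e q eta d - d * cubic e q eta d' by rewrite /cubic; ring.
    by rewrite rd rd' !mulr0 subr0.
  by rewrite mulf_eq0 (gt_eqF pos) orbF subr_eq0 => /eqP.
- apply: (@pexpIrn _ 3); rewrite ?nnegrE //.
  by move: rd rd'; rewrite /cubic eta3; lra.
Qed.

(** The strict lower bound on eta says that the cubic is positive at e.  For
    q <> 0 it is negative at 0 and the intermediate value theorem applies.  For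
    q = 0 that argument could return the spurious root 0, so the other root is
    given explicitly; it is 0 only if eta = 3 e^2. *)
Lemma cubic_root_exists e q eta : 0 < e -> e ^+ 2 + q ^+ 2 / e < eta ->
  (q = 0 -> eta <= 3 * e ^+ 2) ->
  exists d, [/\ 0 <= d, d < e, cubic e q eta d = 0
             & d = 0 -> q = 0 /\ eta = 3 * e ^+ 2].
Proof.
move=> e0 lt_eta flat.
have cubic_e : 0 < cubic e q eta e.
  have -> : cubic e q eta e = e * (eta - (e ^+ 2 + q ^+ 2 / e)).
    by rewrite /cubic; field; rewrite gt_eqF.
  by rewrite mulr_gt0 // subr_gt0.
have [q0|qN0] := eqVneq q 0.
- have eta_le := flat q0; move: lt_eta cubic_e.
  rewrite {}q0 expr0n /= mul0r addr0 => eta_gt _.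
  have x0 : 0 <= (3 * e ^+ 2 - eta) / 2 by lra.
  have sqr := sqr_sqrtr x0.
  exists (Num.sqrt ((3 * e ^+ 2 - eta) / 2)).
  move: (sqrtr_ge0 ((3 * e ^+ 2 - eta) / 2)) sqr.
  set d := Num.sqrt _ => d0 sqr; split=> //.
  + by rewrite -(ltr_pXn2r (_ : 0 < 2)%N) ?nnegrE ?(ltW e0) // sqr; lra.
  + by rewrite /cubic exprS sqr expr0n /=; field.
  + by move=> dE; split=> //; move: sqr; rewrite dE expr0n /=; lra.
- pose p : {poly R} := 2%:P * 'X^3 + (eta - 3 * e ^+ 2)%:P * 'X - (q ^+ 2)%:P.
  have pE d : p.[d] = cubic e q eta d.
    by rewrite /p !(hornerD, hornerN, hornerM, hornerC, hornerXn, hornerX).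
  have cubic_0 : cubic e q eta 0 < 0.
    have : 0 < q ^+ 2 by rewrite exprn_even_gt0.
    by rewrite /cubic expr0n /= mulr0; lra.
  have [d /itvP de /rootP] : exists2 d, d \in `[0, e] & root p d.
    by apply: poly_ivt; rewrite ?(ltW e0) // !pE (ltW cubic_0) (ltW cubic_e).
  rewrite pE => rd; exists d; split=> //; first by rewrite de.
    rewrite lt_neqAle de andbT; apply/eqP => dE.
    by move: rd cubic_e; rewrite dE => ->; rewrite ltxx.
  by move=> dE; move: rd cubic_0; rewrite dE => ->; rewrite ltxx.
Qed.

End Cubic.

(** * Moments of a two-node mixture *)

Section Mixture.
Variable R : realType.
Implicit Types (M N : 'cV[R]_5) (x y : unknowns R).

Lemma col5_eq M N : M 0 0 = N 0 0 -> M 1 0 = N 1 0 -> M 2 0 = N 2 0 ->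
  M 3 0 = N 3 0 -> M 4 0 = N 4 0 -> M = N.
Proof.
move=> h0 h1 h2 h3 h4; apply/colP => i.
have : i \in [:: 0; 1; 2; 3; 4 : 'I_5] by case: i => [[|[|[|[|[|]]]]]].
by rewrite !inE => /or4P[|||/orP[]] /eqP->.
Qed.

(** The raw moments of the Gaussian mixture, each summand being the moment of a
    normal law of mean v_i and variance sigma^2. *)
Definition moments x : 'cV[R]_5 :=
  \col_(i < 5)
    [:: rho1 x + rho2 x;
        rho1 x * v1 x + rho2 x * v2 x;
        rho1 x * (v1 x ^+ 2 + sigma x ^+ 2)
        + rho2 x * (v2 x ^+ 2 + sigma x ^+ 2);
        rho1 x * (v1 x ^+ 3 + 3 * sigma x ^+ 2 * v1 x)
        + rho2 x * (v2 x ^+ 3 + 3 * sigma x ^+ 2 * v2 x);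
        rho1 x * (v1 x ^+ 4 + 6 * sigma x ^+ 2 * v1 x ^+ 2
                  + 3 * sigma x ^+ 4)
        + rho2 x * (v2 x ^+ 4 + 6 * sigma x ^+ 2 * v2 x ^+ 2
                    + 3 * sigma x ^+ 4)]`_i.

Lemma moment_systemE M x : moment_system M x <-> M = moments x.
Proof.
rewrite /moment_system; split=> [[h0 h1 h2 h3 h4]|->]; last first.
  by rewrite !mxE /=; split; ring.
have {}h2 : M 2 0 = sigma x ^+ 2 * M 0 0
  + (rho1 x * v1 x ^+ 2 + rho2 x * v2 x ^+ 2) by rewrite -h2; ring.
have {}h3 : M 3 0 = 3 * sigma x ^+ 2 * M 1 0
  + (rho1 x * v1 x ^+ 3 + rho2 x * v2 x ^+ 3) by rewrite -h3; ring.
have {}h4 : M 4 0 = 6 * sigma x ^+ 2 * M 2 0 - 3 * sigma x ^+ 4 * M 0 0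
  + (rho1 x * v1 x ^+ 4 + rho2 x * v2 x ^+ 4) by rewrite -h4; ring.
apply: col5_eq; rewrite !mxE /= ?h4 ?h3 ?h2 ?h1 ?h0; ring.
Qed.

(** The definitions of e, q and eta can be solved successively for M2, M3 and
    M4. *)
Lemma central_moments_inj M N : 0 < M 0 0 ->
  M 0 0 = N 0 0 -> M 1 0 = N 1 0 -> mom_e M = mom_e N ->
  mom_q M = mom_q N -> mom_eta M = mom_eta N -> M = N.
Proof.
move=> /gt_eqF/negbT M0 E0 E1 Ee Eq Eeta.
have N0 : N 0 0 != 0 by rewrite -E0.
have m2 (K : 'cV[R]_5) : K 0 0 != 0 ->
    K 2 0 = K 0 0 * mom_e K + K 1 0 ^+ 2 / K 0 0.
  by move=> K0; rewrite /mom_e; field.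
have m3 (K : 'cV[R]_5) : K 0 0 != 0 -> K 3 0 =
    K 0 0 * mom_q K + 3 * K 1 0 * mom_e K + K 1 0 ^+ 3 / K 0 0 ^+ 2.
  by move=> K0; rewrite /mom_q /mom_e; field.
have m4 (K : 'cV[R]_5) : K 0 0 != 0 -> K 4 0 =
    K 0 0 * mom_eta K + 4 * K 1 0 * mom_q K
    + 6 * K 1 0 ^+ 2 / K 0 0 * mom_e K + K 1 0 ^+ 4 / K 0 0 ^+ 3.
  by move=> K0; rewrite /mom_eta /mom_q /mom_e; field.
by apply: col5_eq => //; rewrite (m2, m3, m4) // (m2 N, m3 N, m4 N) //
  ?E0 ?E1 ?Ee ?Eq ?Eeta.
Qed.

Definition positive_weights x : Prop := 0 < rho1 x /\ 0 < rho2 x.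

Lemma total_weight_gt0 x : positive_weights x -> 0 < rho1 x + rho2 x.
Proof. by case=> a0 b0; rewrite addr_gt0. Qed.

Lemma total_weight_neq0 x : positive_weights x -> rho1 x + rho2 x != 0.
Proof. by move=> /total_weight_gt0 r0; rewrite gt_eqF. Qed.

(** Dividing by the total weight makes the central moments polynomial in
    [rho1], [rho2] and [gap]. *)
Definition gap x : R := (v2 x - v1 x) / (rho1 x + rho2 x).

Definition node_variance x : R := rho1 x * rho2 x * gap x ^+ 2.

Lemma mom_e_moments x : positive_weights x ->
  mom_e (moments x) = sigma x ^+ 2 + node_variance x.
Proof.
move=> /total_weight_neq0 r0.
by rewrite /node_variance /gap /mom_e !mxE /=; field.
Qed.

Lemma mom_q_moments x : positive_weights x ->
  mom_q (moments x) = node_variance x * ((rho1 x - rho2 x) * gap x).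
Proof.
move=> /total_weight_neq0 r0.
by rewrite /node_variance /gap /mom_q !mxE /=; field.
Qed.

Lemma mom_eta_moments x : positive_weights x ->
  mom_eta (moments x) =
  node_variance x * (((rho1 x - rho2 x) * gap x) ^+ 2 + node_variance x)
  + 6 * sigma x ^+ 2 * node_variance x + 3 * sigma x ^+ 4.
Proof.
move=> /total_weight_neq0 r0.
by rewrite /node_variance /gap /mom_eta !mxE /=; field.
Qed.

(** With d and the skewness factor fixed, this determines the gap up to sign. *)
Lemma sqr_gap x : ((rho1 x + rho2 x) * gap x) ^+ 2 =
  ((rho1 x - rho2 x) * gap x) ^+ 2 + 4 * node_variance x.
Proof. by rewrite /node_variance; ring. Qed.

Lemma cubic_node_variance x : positive_weights x ->
  cubic (mom_e (moments x)) (mom_q (moments x)) (mom_eta (moments x))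
    (node_variance x) = 0.
Proof.
move=> ax.
rewrite /cubic mom_e_moments // mom_q_moments // mom_eta_moments //; ring.
Qed.

Lemma node_variance_ge0 x : positive_weights x -> 0 <= node_variance x.
Proof.
by case=> a0 b0; exact: mulr_ge0 (mulr_ge0 (ltW a0) (ltW b0)) (sqr_ge0 _).
Qed.

Lemma gap_eq0 x : positive_weights x -> gap x = 0 <-> v1 x = v2 x.
Proof.
move=> ax; rewrite /gap; split=> [/eqP|->]; last by rewrite subrr mul0r.
rewrite mulf_eq0 invr_eq0 (negbTE (total_weight_neq0 ax)) orbF subr_eq0.
by move=> /eqP.
Qed.

Lemma node_variance_eq0 x : positive_weights x ->
  node_variance x = 0 <-> v1 x = v2 x.
Proof.
move=> ax; rewrite -gap_eq0 // /node_variance.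
case: ax => /gt_eqF a0 /gt_eqF b0; split=> [/eqP|->].
  by rewrite mulf_eq0 [_ * _ == 0]mulf_eq0 a0 b0 sqrf_eq0 => /eqP.
by rewrite expr0n mulr0.
Qed.

(** Merged nodes form a single Gaussian, which is symmetric with kurtosis 3. *)
Lemma merged_mom x : positive_weights x -> node_variance x = 0 ->
  mom_q (moments x) = 0 /\
  mom_eta (moments x) = 3 * mom_e (moments x) ^+ 2.
Proof.
move=> ax d0; rewrite mom_q_moments // mom_eta_moments // mom_e_moments // d0.
by split; ring.
Qed.

(** Both variances are roots of the same cubic.  If one of them is 0 then
    eta = 3 e^2, so the condition for uniqueness of the root always holds. *)
Lemma node_variance_unique x y : positive_weights x -> positive_weights y ->
  moments x = moments y -> node_variance x = node_variance y.
Proof.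
move=> ax ay Mxy.
have rx := cubic_node_variance ax.
have ry := cubic_node_variance ay.
have dx := node_variance_ge0 ax; have dy := node_variance_ge0 ay.
rewrite -Mxy in ry; apply: (cubic_root_unique _ _ rx ry) => //.
have [x0|xN0] := eqVneq (node_variance x) 0.
  by apply: Or32; case: (merged_mom ax x0).
have [y0|yN0] := eqVneq (node_variance y) 0.
  by apply: Or32; rewrite Mxy; case: (merged_mom ay y0).
by apply: Or33; rewrite !lt_neqAle dx dy !(eq_sym 0) xN0 yN0.
Qed.

Lemma params_eq x y : positive_weights x -> 0 <= sigma x -> 0 <= sigma y ->
  rho1 x = rho1 y -> rho2 x = rho2 y -> gap x = gap y ->
  rho1 x * v1 x + rho2 x * v2 x = rho1 y * v1 y + rho2 y * v2 y ->
  sigma x ^+ 2 = sigma y ^+ 2 -> x = y.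
Proof.
move=> /total_weight_neq0.
rewrite /gap; case: x y => a b u v s [a' b' u' v' s'] /= r0 s0 s'0 ea eb.
rewrite -{}ea -{}eb => gE mE /eqP.
rewrite eqrXn2 // => /eqP <-.
have vu : v - u = v' - u'.
  by move: gE => /(congr1 ( *%R^~ (a + b))); rewrite !divfK.
have uE : u = u'.
  apply: (mulfI r0).
  have -> : (a + b) * u = (a * u + b * v) - b * (v - u) by ring.
  by rewrite mE vu; ring.
by move: vu; rewrite uE => /(congr1 (+%R^~ u')); rewrite !subrK => ->.
Qed.

(** * Mixtures with the same moments *)

Lemma moments_swap x : moments (swap_nodes x) = moments x.
Proof. by apply: col5_eq; rewrite !mxE /= addrC. Qed.

Lemma gap_swap x : gap (swap_nodes x) = - gap x.
Proof. by rewrite /gap /= -mulNr opprB addrC [rho2 x + _]addrC addrC. Qed.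

(** If the common gap g is nonzero then so is d, and q = d (rho1 - rho2) g gives
    the difference of the weights, whose sum is M0.  If g = 0 the convention for
    merged nodes replaces this information. *)
Lemma moments_inj_gap x y : positive_weights x -> positive_weights y ->
  0 <= sigma x -> 0 <= sigma y -> moments x = moments y ->
  equal_weights_if_merged x -> equal_weights_if_merged y ->
  gap x = gap y -> x = y.
Proof.
move=> ax ay sx sy Mxy wx wy gE.
have dE := node_variance_unique ax ay Mxy.
have rE : rho1 x + rho2 x = rho1 y + rho2 y.
  by move: (congr1 (fun M : 'cV[R]_5 => M 0 0) Mxy); rewrite !mxE.
have mE : rho1 x * v1 x + rho2 x * v2 x = rho1 y * v1 y + rho2 y * v2 y.
  by move: (congr1 (fun M : 'cV[R]_5 => M 1 0) Mxy); rewrite !mxE.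
have eE := congr1 (@mom_e R) Mxy; have qE := congr1 (@mom_q R) Mxy.
rewrite !mom_e_moments // dE in eE; have {}eE := addIr _ eE.
rewrite !mom_q_moments // dE -gE in qE.
suff diffE : rho1 x - rho2 x = rho1 y - rho2 y.
  by apply: params_eq => //; lra.
have [g0|gN0] := eqVneq (gap x) 0.
  have gy : gap y = 0 by rewrite -gE.
  by rewrite wx ?wy ?subrr //; apply/gap_eq0.
have dN0 : node_variance y != 0.
  apply/eqP => /node_variance_eq0 - /(_ ay) /gap_eq0 - /(_ ay).
  by rewrite -gE; apply/eqP.
by move: qE => /(mulfI dN0) /(mulIf gN0).
Qed.

(** Equal moments force equal squared gaps; the two choices of sign differ by
    the relabelling of the nodes, which changes the sign of the gap. *)
Lemma moments_fiber x y : positive_weights x -> positive_weights y ->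
  0 <= sigma x -> 0 <= sigma y -> moments x = moments y ->
  v1 x <> v2 x \/ (equal_weights_if_merged x /\ equal_weights_if_merged y) ->
  y = x \/ y = swap_nodes x.
Proof.
move=> ax ay sx sy Mxy nondeg.
have dE := node_variance_unique ax ay Mxy.
have [wx wy] : equal_weights_if_merged x /\ equal_weights_if_merged y.
  case: nondeg => // xN.
  split=> [/xN //|/node_variance_eq0 - /(_ ay)].
  by rewrite -dE => /node_variance_eq0 - /(_ ax) /xN.
have rE : rho1 x + rho2 x = rho1 y + rho2 y.
  by move: (congr1 (fun M : 'cV[R]_5 => M 0 0) Mxy); rewrite !mxE.
have r0 := total_weight_neq0 ax.
have skewE : (rho1 x - rho2 x) * gap x = (rho1 y - rho2 y) * gap y.
  have [d0|dN0] := eqVneq (node_variance y) 0.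
    have /gap_eq0 - /(_ ay) gy : v1 y = v2 y by apply/node_variance_eq0.
    have /gap_eq0 - /(_ ax) gx : v1 x = v2 x.
      by apply/node_variance_eq0; rewrite // dE.
    by rewrite gx gy !mulr0.
  apply: (mulfI dN0); move: (congr1 (@mom_q R) Mxy).
  by rewrite !mom_q_moments // dE.
have : gap x ^+ 2 = gap y ^+ 2.
  apply: (mulfI (expf_neq0 2 r0)).
  by rewrite -exprMn [in RHS]rE -exprMn !sqr_gap skewE dE.
move=> /eqP; rewrite eqf_sqr => /orP[/eqP gE|/eqP gE].
  by left; symmetry; apply: moments_inj_gap.
right; apply: moments_inj_gap; rewrite ?moments_swap ?gap_swap ?gE ?opprK //.
- by case: ax.
- by move=> /= ?; rewrite wx.
Qed.

Lemma solutionE M x :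
  solution M x <-> [/\ positive_weights x, 0 <= sigma x & M = moments x].
Proof.
by split=> [[a b s /moment_systemE]|[[a b] s /moment_systemE]].
Qed.

(** * Solvability on the phase space *)

(** The defining inequality multiplied by e reduces to
    s (d c^2 + 2 e (e + d)) > 0.  When q = 0 and d > 0, the cubic gives
    3 e^2 - eta = 2 d^2. *)
Lemma Omega_moments x : positive_weights x -> 0 < sigma x -> Omega (moments x).
Proof.
move=> ax sx; have r0 := total_weight_gt0 ax.
have d0 := node_variance_ge0 ax.
have s2 : 0 < sigma x ^+ 2 by rewrite exprn_gt0.
have e0 : 0 < mom_e (moments x) by rewrite mom_e_moments // ltr_wpDr.
split=> //; first by rewrite mxE.
- rewrite -(ltr_pM2l e0) -subr_gt0.
  have -> : mom_e (moments x) * mom_eta (moments x) -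
    mom_e (moments x) * (mom_e (moments x) ^+ 2
                         + mom_q (moments x) ^+ 2 / mom_e (moments x)) =
    sigma x ^+ 2 * (node_variance x * ((rho1 x - rho2 x) * gap x) ^+ 2
      + 2 * mom_e (moments x) * (mom_e (moments x) + node_variance x)).
    have -> (e q eta : R) : e != 0 -> e * eta - e * (e ^+ 2 + q ^+ 2 / e)
        = e * eta - e ^+ 3 - q ^+ 2 by move=> ?; field.
      rewrite mom_q_moments // mom_eta_moments // mom_e_moments //; ring.
    by rewrite gt_eqF.
  apply: mulr_gt0 s2 (ltr_wpDl (mulr_ge0 d0 (sqr_ge0 _)) _).
  by apply: mulr_gt0; [apply: mulr_gt0 | apply: ltr_wpDr].
- move=> q0; have := cubic_node_variance ax.
  rewrite /cubic q0; have [dx0 _|dxN0] := eqVneq (node_variance x) 0.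
    by case: (merged_mom ax dx0) => _ ->.
  rewrite expr0n subr0 -[_ ^+ 3]/(_ ^+ (2 + 1)) exprD mulrA -mulrDl => /eqP.
  rewrite mulf_eq0 (negbTE dxN0) orbF => /eqP.
  by have := sqr_ge0 (node_variance x); lra.
Qed.

(** For sigma = 0 one has e = d, and then eta = e^2 + q^2 / e, on the excluded
    boundary of Omega. *)
Lemma solution_sigma_gt0 M x : Omega M -> solution M x -> 0 < sigma x.
Proof.
move=> OM /solutionE[ax]; rewrite le_eqVlt => /orP[/eqP s0 ME|//].
case: OM => _; rewrite ME mom_e_moments // mom_q_moments // mom_eta_moments //.
rewrite -s0 !expr0n /= !mulr0 mul0r add0r !addr0 => dpos.
set d := node_variance x; set c := _ * gap x.
have -> : d ^+ 2 + (d * c) ^+ 2 / d = d * (c ^+ 2 + d).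
  by field; rewrite gt_eqF.
by rewrite ltxx.
Qed.

(** From a root d of the cubic one recovers c = q / d, a gap t >= 0 with
    (r t)^2 = c^2 + 4 d, and the weights with sum r and difference c / t.
    Division by zero yields zero, so for t = 0 the same formulas give equal
    weights and cover the merged case. *)
Lemma exists_ordered_solution M : Omega M ->
  exists2 x, solution M x & ordered_params x.
Proof.
move=> OM; case: (OM) => M0 e0 eta_gt flat.
have [d [d0 de rd dflat]] := cubic_root_exists e0 eta_gt flat.
set r := M 0 0; set c := mom_q M / d.
have cd : d * c = mom_q M.
  have [dE|dN0] := eqVneq d 0; last by rewrite /c mulrC divfK.
  by case: (dflat dE) => -> _; rewrite dE mul0r.
have etaE : mom_eta M = d * (c ^+ 2 + d) + 6 * (mom_e M - d) * d
    + 3 * (mom_e M - d) ^+ 2.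
  have [dE|dN0] := eqVneq d 0.
    by case: (dflat dE) => _ ->; rewrite dE; ring.
  apply: (mulIf dN0); move: rd; rewrite /cubic -cd => /eqP.
  by rewrite subr_eq0 => /eqP; lra.
have disc0 : 0 <= c ^+ 2 + 4 * d by rewrite addr_ge0 ?sqr_ge0 ?mulr_ge0.
have [t t0 rt2] : exists2 t, 0 <= t & (r * t) ^+ 2 = c ^+ 2 + 4 * d.
  exists (Num.sqrt (c ^+ 2 + 4 * d) / r).
    by rewrite divr_ge0 ?sqrtr_ge0 // ltW.
  by rewrite mulrC divfK ?gt_eqF // sqr_sqrtr.
have tc : t = 0 -> c = 0.
  move=> tE; apply/eqP; rewrite -sqrf_eq0; apply/eqP.
  move: rt2; rewrite tE mulr0 expr0n /=.
  by have := sqr_ge0 c; lra.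
set w := c / t.
have wt : w * t = c.
  by have [tE|tN0] := eqVneq t 0; [rewrite tE mulr0 tc | rewrite divfK].
(* If d = 0 then c = 0 by the convention on division. *)
have w_lt : `|w| < r.
  have [tE|tN0] := eqVneq t 0; first by rewrite /w tE invr0 mulr0 normr0.
  have tp : 0 < t by rewrite lt_neqAle eq_sym tN0.
  rewrite /w normrM normfV (gtr0_norm tp) ltr_pdivrMr //.
  rewrite -(ltr_pXn2r (_ : 0 < 2)%N) ?nnegrE ?mulr_ge0 ?(ltW M0) //.
  rewrite real_normK ?num_real // rt2.
  have [dE|dN0] := eqVneq d 0; last first.
    by rewrite ltrDl mulr_gt0 // lt_neqAle eq_sym dN0.
  have : 0 < (r * t) ^+ 2 by rewrite exprn_gt0 ?mulr_gt0.
  by rewrite rt2 /c dE invr0 mulr0 expr0n /= add0r.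
move: w_lt; rewrite ltr_norml => /andP[w1 w2].
pose m := M 1 0 / r.
pose a := (r + w) / 2; pose b := (r - w) / 2.
have a0 : 0 < a by rewrite /a; lra.
have b0 : 0 < b by rewrite /b; lra.
have abE : a + b = r by rewrite /a /b; field.
pose x := Unknowns a b (m - b * t) (m + a * t) (Num.sqrt (mom_e M - d)).
have ax : positive_weights x by [].
have es0 : 0 < mom_e M - d by rewrite subr_gt0.
have s2 : sigma x ^+ 2 = mom_e M - d by rewrite sqr_sqrtr // ltW.
have r0 : r != 0 by rewrite gt_eqF.
have gx : gap x = t.
  rewrite /gap /=; have -> : m + a * t - (m - b * t) = t * (a + b) by ring.
  by rewrite mulfK // abE.
have dx : node_variance x = d.
  rewrite /node_variance gx /= /a /b.
  have -> : (r + w) / 2 * ((r - w) / 2) * t ^+ 2 =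
      ((r * t) ^+ 2 - (w * t) ^+ 2) / 4.
    by field.
  by rewrite rt2 wt; field.
have cx : (rho1 x - rho2 x) * gap x = c.
  by rewrite gx /= /a /b -wt; field.
exists x.
  apply/solutionE; split=> //; first exact: sqrtr_ge0.
  apply: central_moments_inj => //.
  - by rewrite mxE /= abE.
  - rewrite mxE /=.
    have -> : a * (m - b * t) + b * (m + a * t) = (a + b) * m by ring.
    by rewrite abE /m mulrC divfK.
  - by rewrite mom_e_moments // s2 dx subrK.
  - by rewrite mom_q_moments // cx dx.
  - by rewrite mom_eta_moments // cx dx (exprM _ 2 2) s2.
split=> //=.
- by rewrite sqrtr_gt0.
- have vE : m + a * t - (m - b * t) = r * t by rewrite -abE; ring.
  by rewrite -subr_ge0 vE mulr_ge0 // ltW.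
- move=> /(gap_eq0 ax); rewrite gx => tE.
  by rewrite /= /a /b /w tE invr0 mulr0 addr0 subr0.
Qed.

(** * The bijection between moments and parameters *)

Lemma ordered_params_eq x y : ordered_params x -> ordered_params y ->
  moments x = moments y -> x = y.
Proof.
case=> a b s le w [a' b' s' le' w'] Mxy.
have [ax ay] : positive_weights x /\ positive_weights y by [].
have [-> //|yE] :=
  moments_fiber ax ay (ltW s) (ltW s') Mxy (or_intror (conj w w')).
have vE : v1 x = v2 x by apply: le_anti; rewrite le; move: le'; rewrite yE.
have rE := w vE.
by move: rE vE; rewrite yE; case: (x) => ? ? ? ? ? /= -> ->.
Qed.

(** The vector only records the products rho_i * v_i, so nonzero weights are
    needed to recover the nodes. *)
Lemma Uvec_inj x y : positive_weights x -> Uvec x = Uvec y -> x = y.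
Proof.
case=> a0 b0 Uxy.
have coord (i : 'I_5) : Uvec x i 0 = Uvec y i 0 by rewrite Uxy.
move: (coord 0) (coord 1) (coord 2) (coord 3) (coord 4); rewrite !mxE /=.
case: x y a0 b0 {Uxy coord} => a b u v s [a' b' u' v' s'] /= a0 b0 <- <-.
by move=> /(mulfI (lt0r_neq0 a0)) -> /(mulfI (lt0r_neq0 b0)) -> ->.
Qed.

(** Any solution map U that picks ordered parameters inverts [moments], hence is
    a bijection between each set of moments and the ordered parameters that
    produce it. *)
Lemma Uvec_bij U (A : set 'cV[R]_5) (P : set (unknowns R)) :
  (forall M, Omega M ->
     exists x, [/\ solution M x, ordered_params x & U M = Uvec x]) ->
  A `<=` @Omega R -> P `<=` @ordered_params R ->
  (forall x, ordered_params x -> A (moments x) <-> P x) ->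
  set_bij A (@Uvec R @` P) U.
Proof.
move=> UP AO PO AP.
have UA M : A M ->
    exists x, [/\ ordered_params x, M = moments x & U M = Uvec x].
  move=> /AO /UP[x [/solutionE[_ _ ME] ox UE]].
  by exists x.
split.
- move=> M AM; have [x [ox ME ->]] := UA M AM.
  by exists x => //; apply/AP => //; rewrite -ME.
- move=> M N /set_mem /UA[x [[a b _ _ _] -> ->]] /set_mem /UA[y [_ -> ->]].
  by move=> /Uvec_inj ->.
- move=> _ [x Px <-]; have ox := PO x Px.
  have AM : A (moments x) by apply/AP.
  exists (moments x) => //; have [y [oy /esym ME ->]] := UA _ AM.
  by rewrite (ordered_params_eq oy ox ME).
Qed.

End Mixture.

(* If q = 0 and eta < 3 e^2, the polynomial has a second root in ]0, e], namely
   sigma^2 = e (sigma_0 = 0), which solves no moment system; there the root is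
   unique in the open interval ]0, e[ only. *)
Theorem proposition3p1 (R : realType) :
  [/\ forall M : 'cV[R]_5, Omega M ->
        exists2 x, solution M x & equal_weights_if_merged x,
      forall (M : 'cV[R]_5) (x y : unknowns R), Omega M ->
        solution M x -> solution M y ->
        v1 x <> v2 x \/ (equal_weights_if_merged x /\ equal_weights_if_merged y) ->
        y = x \/ y = swap_nodes x,
      exists U : 'cV[R]_5 -> 'cV[R]_5,
        [/\ forall M, Omega M ->
              exists x, [/\ solution M x, ordered_params x & U M = Uvec x],
            set_bij (@Omega_distinct R) (@Uvec R @` @distinct_params R) U
          & set_bij (@Omega R) (@Uvec R @` @ordered_params R) U]
    & forall (M : 'cV[R]_5) (x : unknowns R), Omega M -> solution M x ->
        [/\ sigma x ^+ 2 \in `]0, mom_e M],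
            sigma2_root M (sigma x ^+ 2),
            (mom_q M <> 0 \/ mom_eta M = 3 * mom_e M ^+ 2) ->
              unique (fun s : R => (s \in `]0, mom_e M]) /\ sigma2_root M s)
                     (sigma x ^+ 2)
          & (mom_q M = 0 /\ mom_eta M < 3 * mom_e M ^+ 2) ->
              unique (fun s : R => (s \in `]0, mom_e M[) /\ sigma2_root M s)
                     (sigma x ^+ 2)]].
Proof.
have /choice[U UP] : forall M : 'cV[R]_5, exists u : 'cV[R]_5, Omega M ->
    exists x, [/\ solution M x, ordered_params x & u = Uvec x].
  move=> M; have [OM|NOM] := pselect (Omega M); last by exists 0.
  have [x sx ox] := exists_ordered_solution OM.
  by exists (Uvec x) => _; exists x.
split.
- move=> M /exists_ordered_solution[x sx [_ _ _ _ wx]]; by exists x.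
- move=> M x y OM /solutionE[ax sx Mx] /solutionE[ay sy My] nondeg.
  by apply: moments_fiber => //; rewrite -Mx.
- exists U; split=> //; apply: Uvec_bij => //.
  + by move=> M [].
  + by move=> x [a0 b0 s0 lt_v]; split; rewrite ?ltW // => /eqP; rewrite lt_eqF.
  + move=> x [a0 b0 s0 le_v wx].
    have ax : positive_weights x by [].
    split=> [[_ [y /solutionE[ay _ Mxy] yN]]|[_ _ _ lt_v]].
      split=> //; rewrite lt_neqAle le_v andbT; apply/eqP.
      move=> /(node_variance_eq0 ax).
      by rewrite (node_variance_unique ax ay Mxy) => /(node_variance_eq0 ay).
    split; first exact: Omega_moments.
    exists x; first by apply/solutionE; split; rewrite // ltW.
    by apply/eqP; rewrite lt_eqF.
  + move=> x ox; split=> // _; case: ox => a0 b0 s0 _ _.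
    exact: Omega_moments.
- move=> M x OM sx; have s0 := solution_sigma_gt0 OM sx.
  move: sx => /solutionE[ax _ ME].
  have eE : mom_e M = sigma x ^+ 2 + node_variance x.
    by rewrite ME mom_e_moments.
  have dE : mom_e M - sigma x ^+ 2 = node_variance x by rewrite eE addrC addKr.
  have d0 := node_variance_ge0 ax.
  have s2 : 0 < sigma x ^+ 2 by rewrite exprn_gt0.
  have rd : cubic (mom_e M) (mom_q M) (mom_eta M) (node_variance x) = 0.
    by rewrite ME cubic_node_variance.
  have sM : sigma2_root M (sigma x ^+ 2) by apply/sigma2_rootE; rewrite dE.
  have s_in : sigma x ^+ 2 \in `]0, mom_e M].
    by rewrite in_itv /= s2 eE lerDl.
  have root_unique s : s <= mom_e M -> sigma2_root M s ->
      [\/ mom_q M <> 0, mom_eta M = 3 * mom_e M ^+ 2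
        | 0 < node_variance x /\ 0 < mom_e M - s] -> sigma x ^+ 2 = s.
    move=> le_s /sigma2_rootE rs nondeg.
    have le_s0 : 0 <= mom_e M - s by rewrite subr_ge0.
    have := cubic_root_unique d0 le_s0 rd rs nondeg.
    by rewrite -dE => /addrI /oppr_inj.
  split=> //.
  + move=> nondeg; split=> // s [/itvP s_itv rs].
    apply: root_unique => //; first by rewrite s_itv.
    by case: nondeg; [apply: Or31 | apply: Or32].
  + move=> [q0 eta_lt].
    have dp : 0 < node_variance x.
      rewrite lt_neqAle d0 andbT eq_sym; apply/eqP => /(merged_mom ax).
      by rewrite -ME => -[_ etaE]; move: eta_lt; rewrite etaE ltxx.
    split=> [|s [/itvP s_itv rs]].
      by split=> //; rewrite in_itv /= s2 eE ltrDl.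
    apply: root_unique; rewrite ?s_itv //.
    by apply: Or33; rewrite subr_gt0 s_itv.
Qed.
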